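(* Let $G$ be a finite group. Every Sylow subgroup of $G$ is submodular in $G$ if and only if $G$ is Ore dispersive and every biprimary subgroup of $G$ is strongly supersoluble.
   Context: All groups are finite. A subgroup $M$ of a group $G$ is called modular in $G$ if: (1) $\langle X, M\cap Z\rangle=\langle X,M\rangle\cap Z$ for all $X\le G$, $Z\le G$ with $X\le Z$; and (2) $\langle M, Y\cap Z\rangle=\langle M,Y\rangle\cap Z$ for all $Y\le G$, $Z\le G$ with $M\le Z$. A subgroup $H$ of $G$ is called submodular in $G$ if there is a chain of subgroups $H=H_0\le H_1\le\dots\le H_s=G$ such that $H_{i-1}$ is modular in $H_i$ for $i=1,\dots,s$. A group is called strongly supersoluble if it is supersoluble and every Sylow subgroup of it is submodular in it. A group $G$ of order $p_1^{n_1}p_2^{n_2}\cdots p_k^{n_k}$, with primes $p_1>p_2>\dots>p_k$, is called Ore dispersive if $G$ has a normal subgroup of order $p_1^{n_1}p_2^{n_2}\cdots p_i^{n_i}$ for every $i=1,\dots,k$. A group is biprimary if its order is divisible by exactly two distinct primes. *)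

(* Defs.v *)
From mathcomp Require Import all_boot all_fingroup all_solvable.

Set Implicit Arguments.
Unset Strict Implicit.
Unset Printing Implicit Defensive.

Local Open Scope group_scope.

Section Defs.

Variable gT : finGroupType.
Implicit Types G H M X Y Z U V : {group gT}.

(* Boolean, so that [path] can chain it; [X <*> Y] is the subgroup generated
   by [X] and [Y], and subgroups of G are the groups contained in G. *)
Definition modular M G : bool :=
  [&& M \subset G,
      [forall X : {group gT}, forall Z : {group gT},
         [&& X \subset G, Z \subset G & X \subset Z] ==>
         (X <*> (M :&: Z) == (X <*> M) :&: Z)]
    & [forall Y : {group gT}, forall Z : {group gT},
         [&& Y \subset G, Z \subset G & M \subset Z] ==>
         (M <*> (Y :&: Z) == (M <*> Y) :&: Z)]].

Definition submodular H G : Prop :=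
  exists2 s : seq {group gT}, path modular H s & last H s = G.

(* The library's [Sylow G P] does not name the prime; it also accepts P = 1,
   the Sylow p-subgroup for p not dividing #|G|, which is always modular. *)
Definition sylow_submodular G : Prop :=
  forall P : {group gT}, Sylow G P -> submodular P G.

Definition cyclic_normal_factor G U V : bool :=
  [&& U <| G, V <| G, U \subset V & cyclic (V / U)].

(* A series 1 = N_0 <= ... <= N_s = G of normal subgroups of G with cyclic
   factors. *)
Definition supersoluble G : Prop :=
  exists2 s : seq {group gT},
    path (cyclic_normal_factor G) 1%G s & last 1%G s = G.

Definition strongly_supersoluble G : Prop :=
  supersoluble G /\ sylow_submodular G.

(* [primes] is increasing, so [rev] lists p_1 > ... > p_k; [n`_p] is the
   p-part of n. *)
Definition ore_dispersive G : Prop :=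
  let ps := rev (primes #|G|) in
  forall i : nat, 0 < i <= size ps ->
  exists2 N : {group gT}, N <| G & #|N| = (\prod_(p <- take i ps) #|G|`_p)%N.

Definition biprimary G : bool := size (primes #|G|) == 2.

End Defs.

(* Main.v *)
Require Import Defs.
From mathcomp Require Import all_boot all_fingroup all_solvable.

(** If M is a maximal subgroup of G that is modular in G, then X :&: M is
    maximal in X for every X <= G not contained in M. When M is moreover
    core-free, this forces every Sylow subgroup of G to be elementary abelian
    and, for the smallest prime p dividing #|G| and P a Sylow p-subgroup,
    [P, N_G(P)] <= M for all conjugates of P, so that N_G(P) = C_G(P) and
    Burnside's transfer theorem gives a normal p-complement.

    Suppose that all Sylow subgroups of G are submodular; this passes to
    subgroups and quotients. Let R be a Sylow r-subgroup for the largest prime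
    r. In a minimal counterexample to R <| G, every proper subgroup containing
    R normalises R; hence a proper modular subgroup M containing R equals
    N_G(R), is maximal and core-free, and the normal p-complement, which
    contains R, gives a contradiction. So G is Ore dispersive. If #|G| has at
    most two prime divisors and Q is a complement of R, a minimal normal
    subgroup N of G inside R is central in R, so Q is maximal, hence modular,
    in NQ, and then 1 = N :&: Q is maximal in N; thus G is supersoluble by
    induction.

    Conversely, let R be the normal Sylow subgroup for the largest prime and P
    a Sylow subgroup for another prime. P is submodular in the biprimary group
    RP, and RP is submodular in G because, by induction, P is submodular in a
    complement of R. *)

Set Implicit Arguments.
Unset Strict Implicit.
Unset Printing Implicit Defensive.

Local Open Scope group_scope.

(** * Modular subgroups: normal subgroups and intersections *)

Section Modular.

Variable gT : finGroupType.
Implicit Types G H K L M N X Y Z : {group gT}.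

Lemma modularP M G :
  reflect
    [/\ M \subset G,
        forall X Z, X \subset Z -> Z \subset G ->
          X <*> (M :&: Z) = (X <*> M) :&: Z
      & forall Y Z, Y \subset G -> M \subset Z -> Z \subset G ->
          M <*> (Y :&: Z) = (M <*> Y) :&: Z]
    (modular M G).
Proof.
apply: (iffP and3P) => [[sMG modX modY] | [sMG modX modY]]; split=> //.
- move=> X Z sXZ sZG; apply/eqP.
  have /forallP/(_ Z)/implyP := forallP modX X.
  by apply; rewrite sZG sXZ (subset_trans sXZ).
- move=> Y Z sYG sMZ sZG; apply/eqP.
  have /forallP/(_ Z)/implyP := forallP modY Y.
  by apply; rewrite sYG sZG.
- apply/forallP=> X; apply/forallP=> Z; apply/implyP=> /and3P[_ sZG sXZ].
  by apply/eqP; apply: modX.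
apply/forallP=> Y; apply/forallP=> Z; apply/implyP=> /and3P[sYG sZG sMZ].
by apply/eqP; apply: modY.
Qed.

Lemma modular_sub M G : modular M G -> M \subset G.
Proof. by case/and3P. Qed.

Lemma normal_modular M G : M <| G -> modular M G.
Proof.
case/andP=> sMG nMG; apply/modularP; split=> // [X Z sXZ sZG | Y Z sYG sMZ sZG].
  have nMX := subset_trans (subset_trans sXZ sZG) nMG.
  rewrite norm_joinEl // norm_joinEl; first exact: group_modl.
  by apply: normsI => //; exact: subset_trans sXZ (normG Z).
rewrite norm_joinEr ?norm_joinEr ?(subset_trans sYG) //; first exact: group_modl.
by rewrite subIset // (subset_trans sYG).
Qed.

Lemma modularI M G H : H \subset G -> modular M G -> modular (M :&: H)%G H.
Proof.
move=> sHG /modularP[sMG modX modY]; apply/modularP.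
have MH Z : Z \subset H -> M :&: H :&: Z = M :&: Z.
  by move=> sZH; rewrite -setIA (setIidPr sZH).
have modH X : X \subset H -> X <*> (M :&: H) = (X <*> M) :&: H.
  by move=> sXH; apply: modX.
split=> [|X Z sXZ sZH|Y Z sYH sIZ sZH] /=; first exact: subsetIr.
  rewrite MH // modH ?(subset_trans sXZ) // -setIA (setIidPr sZH).
  by apply: modX; rewrite // (subset_trans sZH).
(* The first law gives [Z = H :&: (M <*> Z)], so [Z] can be traded for [M <*> Z], an overgroup of
   [M] to which the second law of [M] applies. *)
have eqYZ : Y :&: Z = Y :&: (M <*> Z).
  apply/eqP; rewrite eqEsubset setIS ?joing_subr //= subsetI subsetIl /=.
  have defZ : H :&: (M <*> Z) = Z.
    by rewrite setIC (joingC M) -modH // (joing_idPl sIZ).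
  by rewrite -[X in _ \subset gval X](group_inj defZ) setSI.
have sZG := subset_trans sZH sHG; have sYG := subset_trans sYH sHG.
rewrite !(joingC (M :&: H)) modH // -setIA (setIidPr sZH).
have -> : (Y :&: Z) <*> (M :&: H) = (Y :&: Z) <*> (M :&: Z).
  congr (_ <*> _); rewrite -[in RHS](setIidPr sZH) setIA.
  by rewrite (setIidPl sIZ).
rewrite modX ?subsetIr //= joingC eqYZ modY ?joing_subl ?join_subG ?sMG //.
by rewrite (joingC Y) -setIA (setIidPr (joing_subr M Z)).
Qed.

End Modular.

(** * Modularity under images and preimages *)

(** Images respect joins, and also intersections once one side contains the kernel; passing to full
    preimages ensures this. *)
Lemma modular_morphim (aT rT : finGroupType) (G M : {group aT})
    (f : {morphism G >-> rT}) :
  modular M G -> modular (f @* M)%G (f @* G)%G.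
Proof.
case/modularP=> sMG modX modY; apply/modularP.
split=> [|X Z sXZ sZG|Y Z sYG sMZ sZG] /=; first exact: morphimS.
  have sXG := subset_trans sXZ sZG.
  rewrite -(morphpreK sXG) -(morphpreK sZG) -morphimIG ?ker_sub_pre //.
  rewrite -morphimY ?subsetIl ?subIset ?sMG ?subxx //.
  rewrite -[_ <*> (f @* M)]morphimY ?subsetIl // -morphimIG ?ker_sub_pre //.
  by congr (f @* _); apply: (modX (f @*^-1 X)%G (f @*^-1 Z)%G);
    rewrite ?morphpreS ?subsetIl.
rewrite -(morphpreK sYG) -(morphpreK sZG) -morphimIG ?ker_sub_pre //.
rewrite -morphimY ?subIset ?subxx // -[(f @* M) <*> _]morphimY ?subsetIl //.
rewrite -morphimIG ?ker_sub_pre //; congr (f @* _).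
by apply: (modY (f @*^-1 Y)%G (f @*^-1 Z)%G); rewrite ?subsetIl // -sub_morphim_pre.
Qed.

Section ModularQuotient.

Variable gT : finGroupType.
Implicit Types G H K L M N X Y Z : {group gT}.

(** Both laws lift from [G / N] for subgroups containing [N]; Dedekind's law removes that
    restriction. *)
Lemma modular_normal_sup M G N :
  N <| G -> N \subset M -> modular (M / N)%G (G / N)%G -> M \subset G ->
  modular M G.
Proof.
case/andP=> sNG nNG sNM /modularP[_ modX modY] sMG; apply/modularP.
have nN K : K \subset G -> K \subset 'N(N) by move/subset_trans; apply.
have inj (A B : {group gT}) : A \subset G -> B \subset G ->
    N \subset A -> N \subset B -> A / N = B / N -> A :=: B.
  move=> sAG sBG sNA sNB eqAB; apply/eqP; rewrite eqEsubset.
  by rewrite -(quotientSGK (nN _ sAG)) // -(quotientSGK (nN _ sBG)) // eqAB subxx.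
have NZ (K Z : {group gT}) : N \subset K -> Z \subset G ->
    K :&: (Z <*> N) = (K :&: Z) * N.
  move=> sNK sZG; rewrite norm_joinEl ?nN //.
  by rewrite group_modr.
split=> // [X Z sXZ sZG | Y Z sYG sMZ sZG].
  have sXG := subset_trans sXZ sZG.
  have eqI : X <*> M = (X <*> N) <*> M by rewrite -joingA (joing_idPr sNM).
  have sZNG : Z <*> N \subset G by rewrite join_subG sZG.
  have sXNG : X <*> N \subset G by rewrite join_subG sXG.
  have key : (X <*> N) <*> (M :&: (Z <*> N)) = (X <*> M) :&: (Z <*> N).
    rewrite eqI; apply: inj; rewrite /= ?join_subG ?sXG ?sNG ?sMG //.
    - by rewrite subIset ?sMG.
    - by rewrite subIset ?sZNG ?orbT.
    - by rewrite (subset_trans (joing_subr X N)) ?joing_subl.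
    - by rewrite subsetI joing_subr (subset_trans sNM) ?joing_subr.
    rewrite quotientY ?nN ?subIset ?sMG // quotientIG ?joing_subr //.
    rewrite quotientIG ?joing_subr // (quotientY (nN _ sXNG) (nN _ sMG)).
    apply: (modX (X <*> N / N)%G (Z <*> N / N)%G); rewrite quotientS //.
    by rewrite join_subG joing_subr (subset_trans sXZ) ?joing_subl.
  (* Intersecting [key] with [Z] returns from [Z <*> N] to [Z], because [N :&: Z] already lies in
     [M :&: Z]. *)
  have sIZ : X <*> (M :&: Z) \subset Z by rewrite join_subG sXZ subsetIr.
  have -> : (X <*> M) :&: Z = (X <*> M) :&: (Z <*> N) :&: Z.
    by rewrite -setIA (setIidPr (joing_subl Z N)).
  rewrite -key NZ // -norm_joinEl ?nN ?subIset ?sMG // joingA.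
  have -> : X <*> N <*> (M :&: Z) <*> N = (X <*> (M :&: Z)) <*> N.
    by rewrite -!joingA [N <*> _](joing_idPr (joing_subr _ _)).
  rewrite [_ <*> N]norm_joinEl ?nN ?(subset_trans sIZ) // -group_modl //.
  by rewrite mulGSid // (subset_trans _ (joing_subr _ _)) ?setSI.
have sYNG : Y <*> N \subset G by rewrite join_subG sYG.
have sNZ := subset_trans sNM sMZ.
have -> : M <*> (Y :&: Z) = M <*> ((Y <*> N) :&: Z).
  rewrite [(Y <*> N) :&: Z]setIC NZ // -norm_joinEl ?nN ?subIset ?sYG ?orbT //.
  by rewrite setIC (joingC _ N) joingA (joing_idPl sNM).
have -> : M <*> Y = M <*> (Y <*> N).
  by rewrite (joingC Y) joingA (joing_idPl sNM).
apply: inj; rewrite /= ?join_subG ?subIset ?sMG ?sYG ?sNG ?sZG ?orbT //.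
- by rewrite (subset_trans sNM) ?joing_subl.
- by rewrite subsetI sNZ (subset_trans sNM) ?joing_subl.
rewrite quotientY ?nN ?subIset ?sYNG // quotientIG // quotientIG //.
rewrite (quotientY (nN _ sMG) (nN _ sYNG)).
by apply: (modY (Y <*> N / N)%G (Z / N)%G); rewrite quotientS.
Qed.

End ModularQuotient.

(** * Submodular subgroups *)

Section Submodular.

Variable gT : finGroupType.
Implicit Types G H K L M N P : {group gT}.

Lemma submodular_refl G : submodular G G.
Proof. by exists [::]. Qed.

Lemma submodular_step M L G : modular M L -> submodular L G -> submodular M G.
Proof. by move=> modML [s s_path s_last]; exists (L :: s); rewrite //= modML. Qed.

(** Downward induction along a chain, starting at [G]; it spares handling the sequence itself. *)
Lemma submodular_ind_step (Q : {group gT} -> Prop) G :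
    Q G ->
    (forall M L, modular M L -> submodular L G -> Q L -> Q M) ->
  forall H, submodular H G -> Q H.
Proof.
move=> QG IH H [s]; elim: s H => [|L s IHs] H /= => [_ -> // | /andP[modHL Ls] lastG].
by apply: IH modHL _ (IHs _ Ls lastG); exists s.
Qed.

Lemma submodular_trans L M G : submodular M L -> submodular L G -> submodular M G.
Proof.
move=> subML subLG; elim/submodular_ind_step: M / subML => // M K modMK _.
exact: submodular_step.
Qed.

Lemma submodular_sub M G : submodular M G -> M \subset G.
Proof.
elim/submodular_ind_step: M / => // M L modML _.
by apply: subset_trans; apply: modular_sub.
Qed.

(** [K] is the last term of a chain that differs from [G]. *)
Lemma submodular_proper M G :
    submodular M G -> M \proper G ->
  exists2 K : {group gT}, K \proper G & modular K G /\ M \subset K.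
Proof.
elim/submodular_ind_step: M / => [|M L modML subLG IH sMG]; first by rewrite properxx.
have sML := modular_sub modML.
have [ltLG | ] := boolP (L \proper G).
  have [K ltKG [modK sLK]] := IH ltLG.
  by exists K => //; split=> //; apply: subset_trans sLK.
rewrite properE (submodular_sub subLG) negbK => sGL.
have defL : L = G by apply/eqP; rewrite -val_eqE eqEsubset sGL (submodular_sub subLG).
by exists M => //; split; rewrite // -defL.
Qed.

Lemma submodularI H M G : H \subset G -> submodular M G -> submodular (M :&: H)%G H.
Proof.
move=> sHG; elim/submodular_ind_step: M / => [|M L modML _].
  have -> : (G :&: H)%G = H by apply/val_inj/setIidPr.
  exact: submodular_refl.
apply: submodular_step; have := modularI (subsetIl L H) modML.
congr (is_true (modular _ _)); apply: val_inj => /=.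
by rewrite setIA (setIidPl (modular_sub modML)).
Qed.

Lemma sylow_submodularS H G : H \subset G -> sylow_submodular G -> sylow_submodular H.
Proof.
move=> sHG subG Q /SylowP[p p_pr sylQ].
have [P sylP sQP] := Sylow_superset (subset_trans (pHall_sub sylQ) sHG) (pHall_pgroup sylQ).
have <- : (P :&: H)%G = Q.
  apply/val_inj/(sub_pHall sylQ); rewrite ?subsetIr ?subsetI ?sQP ?(pHall_sub sylQ) //.
  exact: pgroupS (subsetIl P H) (pHall_pgroup sylP).
apply: (submodularI sHG); apply: subG; exact: p_Sylow sylP.
Qed.

End Submodular.

(** * Submodularity in quotients *)

Section SubmodularQuotient.

Variable gT : finGroupType.
Implicit Types G H K L M N P : {group gT}.

Lemma submodular_quotient M G N :
  G \subset 'N(N) -> submodular M G -> submodular (M / N)%G (G / N)%G.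
Proof.
move=> nNG; elim/submodular_ind_step: M / => [|M L modML subLG].
  exact: submodular_refl.
apply: submodular_step.
have nNL := subset_trans (submodular_sub subLG) nNG.
have sML := modular_sub modML.
(* The coset map is restricted to [L], so that its domain is the group in which [M] is modular. *)
have := modular_morphim (restrm_morphism nNL (coset_morphism N)) modML.
congr (is_true (modular _ _)); apply: val_inj => /=; rewrite morphim_restrm.
  by rewrite (setIidPr sML).
by rewrite setIid.
Qed.

Lemma submodular_normal_sup M G N :
  N <| G -> N \subset M -> M \subset G -> submodular (M / N)%G (G / N)%G ->
  submodular M G.
Proof.
move=> nsNG sNM sMG; have [sNG nNG] := andP nsNG.
have nNM := subset_trans sMG nNG.
(* A whole chain has to be lifted, so the claim is made for arbitrary subgroups of [G / N]. *)
suff: forall K : {group coset_of N}, submodular K (G / N)%G ->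
    submodular (coset N @*^-1 K)%G G.
  move/(_ (M / N)%G) => imp /imp.
  have -> // : (coset N @*^-1 (M / N))%G = M.
  by apply: val_inj; rewrite /= quotientGK // /normal sNM.
move=> K; elim/submodular_ind_step: K / => [|K L modKL subLG].
  have -> : (coset N @*^-1 (G / N))%G = G by apply: val_inj; rewrite /= quotientGK.
  exact: submodular_refl.
apply: submodular_step.
have sLG : coset N @*^-1 L \subset G.
  by rewrite -(quotientGK nsNG) morphpreS ?submodular_sub.
have sNpre (A : {group coset_of N}) : N \subset coset N @*^-1 A.
  by rewrite -{1}(ker_coset N) ker_sub_pre.
have defpre (A : {group coset_of N}) : (coset N @*^-1 A / N)%G = A.
  by apply: val_inj; rewrite /= cosetpreK.
apply: (modular_normal_sup (N := N)) => //.
- by rewrite /normal sNpre (subset_trans sLG).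
- exact: sNpre.
- by rewrite !defpre.
by rewrite morphpreS ?modular_sub.
Qed.

Lemma sylow_submodular_quotient G N :
  N <| G -> sylow_submodular G -> sylow_submodular (G / N)%G.
Proof.
case/andP=> sNG nNG subG Q /SylowP[p p_pr sylQ].
have [P sylP] := Sylow_exists p G.
have [x] := Sylow_trans (quotient_pHall (subset_trans (pHall_sub sylP) nNG) sylP) sylQ.
case/morphimP=> y nNy Gy -> defQ.
have -> : Q = (P :^ y / N)%G by apply: val_inj; rewrite /= defQ quotientJ.
apply: submodular_quotient nNG _; apply: subG.
by apply: (p_Sylow (p := p)); rewrite pHallJ.
Qed.

End SubmodularQuotient.

(** * Burnside's transfer theorem *)

(** Both [P] and [P :^ x] centralise [u ^ x], so some [y] in ['C_G[u ^ x]] conjugates [P :^ x] to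
    [P]; then [x * y] normalises, hence centralises, [P]. *)
Lemma abelian_Sylow_fusion p (gT : finGroupType) (G P : {group gT}) :
    p.-Sylow(G) P -> abelian P -> 'N_G(P) \subset 'C(P) ->
  {in P & G, forall u x, u ^ x \in P -> u ^ x = u}.
Proof.
move=> sylP abP cPN u x Pu Gx Pux; have [sPG pP _] := and3P sylP.
have sylC (Q : {group gT}) : p.-Sylow(G) Q -> Q \subset 'C[u ^ x] ->
    p.-Sylow('C_G[u ^ x]) Q.
  by move=> sylQ cQ; apply: (pHall_subl _ _ sylQ); rewrite ?subsetIl // subsetI (pHall_sub sylQ).
have sylP1 : p.-Sylow('C_G[u ^ x]) P.
  by apply: sylC => //; rewrite sub_cent1 (subsetP abP).
have sylP2 : p.-Sylow('C_G[u ^ x]) (P :^ x).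
  by apply: sylC; rewrite ?pHallJ // sub_cent1 centJ memJ_conjg (subsetP abP).
have [y /setIP[Gy cuy] defP] := Sylow_trans sylP2 sylP1.
have cPxy : x * y \in 'C(P).
  by rewrite (subsetP cPN) // inE groupM //= inE conjsgM -defP.
have /conjg_fixP <- : [~ u ^ x, y] == 1 by apply/commgP/cent1P; rewrite cent1C.
by rewrite -conjgM; apply/conjg_fixP/commgP/commute_sym/(centP cPxy).
Qed.

Section Burnside.

Import FiniteModule.

Lemma Burnside_transfer p (gT : finGroupType) (G P : {group gT}) :
    p.-Sylow(G) P -> 'N_G(P) \subset 'C(P) ->
  exists2 K : {group gT}, K <| G & p^'.-Hall(G) K.
Proof.
move=> sylP cPN; have [sPG pP p'GP] := and3P sylP.
have abP : abelian P by apply: subset_trans cPN; rewrite subsetI sPG normG.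
have fusP := abelian_Sylow_fusion sylP abP cPN.
(* The transfer is taken along a morphism from [P] with abelian image, here the identity of [P]. *)
have abA : abelian (idm P @* P) by rewrite morphim_idm.
have memA v : v \in P -> v \in (idm_morphism P @* P)%G by rewrite /= morphim_idm.
pose V := transfer_morphism G abA.
(* In the cycle expansion each factor is a conjugate in [P] of a power of [u], equal to that power
   by [fusP]; the exponents add up to [#|G : P|]. *)
have VE : {in P, forall u, V u = fmod abA (u ^+ #|G : P|)}.
  move=> u Pu; have Gu := subsetP sPG u Pu.
  have trX := transversalP (rcosets_cycle_partition sPG Gu).
  set X := transversal _ _ in trX.
  have sXG : {subset X <= G} by apply/subsetP/(transversal_sub trX).
  rewrite /= (transfer_cycle_expansion sPG abA Gu trX).
  rewrite -(sum_index_rcosets_cycle sPG Gu trX).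
  rewrite -[RHS]/(fmod abA _) (big_morph (fun n => fmod abA (u ^+ n)) (id1 := 0%R) (op1 := +%R)).
  - apply: eq_bigr => x Xx; rewrite /restrm /= fusP ?groupX ?groupV ?sXG //.
    by rewrite conjgE invgK mulgA -mem_rcoset mulg_exp_card_rcosets.
  - by move=> m n; rewrite expgD fmodM ?memA ?groupX.
  by rewrite expg0 fmod1.
(* [#|G : P|] is prime to [p], so [V] is injective on [P]. *)
have tiKP : 'ker V :&: P = 1.
  apply/trivgP/subsetP=> u /setIP[/morphpreP[Gu /set1P Vu1] Pu].
  have Pun : u ^+ #|G : P| \in P by rewrite groupX.
  have : val (V u) = u ^+ #|G : P| by rewrite VE // fmodK ?memA.
  rewrite Vu1 => /esym/eqP.
  rewrite -order_dvdn => dv_u; rewrite inE -order_eq1 -dvdn1.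
  rewrite -(eqnP (p'nat_coprime p'GP pP : coprime _ _)) dvdn_gcd dv_u.
  by rewrite order_dvdG.
have nsK : 'ker V <| G by apply: ker_normal.
exists ('ker V)%G => //; rewrite /pHall normal_sub //=; apply/andP; split.
  have := Hall_setI_normal nsK sylP.
  by rewrite /= setIC tiKP => /and3P[_ _]; rewrite indexg1.
rewrite pnatNK -card_quotient ?normal_norm //.
rewrite (card_isog (first_isog V)).
have sVG : V @* G \subset fmod_morphism abA @* (idm_morphism P @* P)%G.
  apply/subsetP=> z _; rewrite -(fmvalK z).
  by rewrite mem_morphim ?fmodP.
by rewrite -/(pgroup _ _) (pgroupS sVG) ?morphim_pgroup.
Qed.

End Burnside.

(** The action of [G] on [K] has an image in [Aut K], of order [p.-1]; a prime divisor of the order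
    of this image would divide [#|G|] and be smaller than [p]. *)
Lemma min_prime_normal_central p (gT : finGroupType) (G K : {group gT}) :
    prime p -> {in \pi(G), forall q, p <= q} -> G \subset 'N(K) -> #|K| = p ->
  G \subset 'C(K).
Proof.
move=> p_pr minp nKG oK; have cycK : cyclic K by rewrite prime_cyclic ?oK.
rewrite -ker_conj_aut -sub_morphim_pre // subG1 trivg_card1.
apply: contraT => ntG; set n := #|_| in ntG.
have n_gt1 : 1 < n by rewrite ltn_neqAle eq_sym ntG cardG_gt0.
have n_G : n %| #|G| by apply: dvdn_morphim.
have n_p : n %| p.-1.
  rewrite -(totient_prime p_pr) -oK -card_Aut_cyclic // cardSg //.
  exact: Aut_conj_aut.
have := minp (pdiv n); rewrite mem_primes pdiv_prime // cardG_gt0 /=.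
rewrite (dvdn_trans (pdiv_dvd n)) // => /(_ isT).
have p_gt1 := prime_gt1 p_pr.
rewrite leqNgt (@leq_ltn_trans p.-1) ?prednK ?prime_gt0 //.
by rewrite dvdn_leq ?(dvdn_trans (pdiv_dvd n)) // -subn1 subn_gt0.
Qed.

(** * Maximal subgroups that are modular *)

Section MaximalModular.

Variables (gT : finGroupType) (G M : {group gT}).
Hypotheses (maxM : maximal M G) (modM : modular M G).

(** By the first law, any [Z] between [X :&: M] and [X] equals [(Z <*> M) :&: X], and [Z <*> M] is
    [M] or [G]. *)
Lemma maximal_modular_setI (X : {group gT}) : X \subset G -> maximal_eq (X :&: M) X.
Proof.
move=> sXG; have [_ modX _] := modularP _ _ modM.
apply/maximal_eqP; split=> [|Z sIZ sZX]; first exact: subsetIl.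
have defZ : Z :=: (Z <*> M) :&: X.
  by rewrite -modX // setIC (joing_idPl sIZ).
have sZG := subset_trans sZX sXG.
have [ltZMG | ] := boolP (Z <*> M \proper G).
  left; rewrite defZ setIC; congr (_ :&: _).
  have [_ maxM'] := maxgroupP maxM.
  by rewrite -[RHS](maxM' (Z <*> M)%G ltZMG (joing_subr _ _)).
rewrite properE join_subG sZG (modular_sub modM) negbK => sGZM.
by right; rewrite defZ; apply/setIidPr/(subset_trans sXG).
Qed.

Lemma maximal_modular_Phi (X : {group gT}) : X \subset G -> 'Phi(X) \subset M.
Proof.
case/maximal_modular_setI/predU1P=> [/setIidPl sXM | maxI].
  exact: subset_trans (Phi_sub X) sXM.
exact: subset_trans (Phi_sub_max maxI) (subsetIr X M).
Qed.

(** Unless [P] lies in [M], the intersection [P :&: M] has index [p] in [P] and is normal in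
    ['N_G(P)]; the factor of order [p] is then central. *)
Lemma maximal_modular_comm p (P : {group gT}) :
    prime p -> {in \pi(G), forall q, p <= q} -> p.-group P -> abelian P ->
  P \subset G -> [~: P, 'N_G(P)] \subset M.
Proof.
move=> p_pr minp pP abP sPG; set X := 'N_G(P).
have sXG : X \subset G := subsetIl _ _.
have nPX : X \subset 'N(P) := subsetIr _ _.
have sPX : P \subset X by rewrite subsetI sPG normG.
have sRP : [~: P, X] \subset P by rewrite commg_subl.
have [sPM | not_sPM] := boolP (P \subset M); first exact: subset_trans sRP sPM.
have maxPM : maximal (P :&: M) P.
  by have /predU1P[/setIidPl|] := maximal_modular_setI sPG; rewrite // (negPf not_sPM).
have maxXM : maximal (X :&: M) X.
  have /predU1P[/setIidPl sXM|] := maximal_modular_setI sXG; rewrite //.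
  by rewrite (subset_trans sPX) in not_sPM.
set B := P :&: M.
have nBP : P \subset 'N(B) by apply: sub_abelian_norm => //; apply: subsetIl.
have nBM : X :&: M \subset 'N(B).
  apply: normsI; first exact: subset_trans (subsetIl _ _) nPX.
  exact: subset_trans (subsetIr _ _) (normG M).
(* Both [P], being abelian, and [X :&: M] normalise [B]; maximality of [X :&: M] makes them generate
   [X]. *)
have defX : P <*> (X :&: M) = X.
  apply/eqP; rewrite eqEproper join_subG sPX subsetIl /=.
  apply: contra not_sPM => ltX; have [_ maxX] := maxgroupP maxXM.
  have sPI : P \subset (X :&: M)%G.
    by rewrite -(maxX (P <*> (X :&: M))%G ltX (joing_subr _ _)) joing_subl.
  exact: subset_trans sPI (subsetIr X M).
have nBX : X \subset 'N(B) by rewrite -defX join_subG nBP.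
have oPB : #|P / B| = p by rewrite card_quotient // (p_maximal_index pP).
have : X / B \subset 'C(P / B).
  apply: (min_prime_normal_central p_pr); rewrite ?quotient_norms //.
  move=> q /(pi_of_dvd (dvdn_quotient X B) (cardG_gt0 X)) q_X.
  by apply/minp/(pi_of_dvd (cardSg sXG)).
rewrite quotient_cents2 // commGC => /subset_trans; apply; exact: subsetIr.
Qed.

Lemma maximal_modular_nilpotent p :
    gcore M G = 1 -> prime p -> {in \pi(G), forall q, p <= q} ->
  exists2 K : {group gT}, K <| G & p^'.-Hall(G) K.
Proof.
move=> coreM p_pr minp; have [P sylP] := Sylow_exists p G.
have [sPG pP _] := and3P sylP.
(* A subgroup attached to [P] compatibly with conjugation lies in the core, hence is trivial, once
   all its conjugates lie in [M]. This is applied to ['Phi(P)] and to [[~: P, 'N_G(P)]]. *)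
have in_core (f : {group gT} -> {group gT}) :
    (forall x, x \in G -> f (P :^ x)%G = (f P :^ x)%G) ->
    (forall x, x \in G -> f (P :^ x)%G \subset M) -> f P :=: 1.
  move=> fJ fM; apply/trivgP; rewrite -coreM.
  apply/bigcapsP=> x Gx; rewrite -sub_conjgV.
  by have := fM x^-1; rewrite groupV fJ ?groupV //; apply.
have PhiP : 'Phi(P) = 1.
  apply: (in_core (fun Q => 'Phi(Q)%G)) => [x _ | x Gx].
    by apply: val_inj; rewrite /= PhiJ.
  by apply: maximal_modular_Phi; rewrite /= conj_subG.
have abP (Q : {group gT}) : p.-Sylow(G) Q -> abelian Q.
  have abelP : p.-abelem P by rewrite -trivg_Phi ?PhiP.
  move=> sylQ; have [x _ ->] := Sylow_trans sylP sylQ.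
  by rewrite abelianJ; case/and3P: abelP.
have : [~: P, 'N_G(P)] = 1.
  apply: (in_core (fun Q => [~: Q, 'N_G(Q)]%G)) => [x Gx|x Gx].
    by apply: val_inj; rewrite /= conjsRg conjIg -normJ (conjGid Gx).
  have sylPx : p.-Sylow(G) (P :^ x) by rewrite pHallJ.
  by apply: (maximal_modular_comm p_pr minp); rewrite /= ?pgroupJ ?abP ?conj_subG.
move/commG1P; rewrite centsC => cPN; exact: (Burnside_transfer sylP cPN).
Qed.

End MaximalModular.

(** * Normality of the Sylow subgroup for the largest prime *)

Lemma normal_pHall_sub_trans (pi : nat_pred) (gT : finGroupType) (G K H : {group gT}) :
  pi.-Hall(G) H -> H \subset K -> H <| K -> K <| G -> H <| G.
Proof.
move=> hallH sHK nsHK nsKG.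
have hallK := pHall_subl sHK (normal_sub nsKG) hallH.
rewrite -(normal_Hall_pcore hallK nsHK).
exact: char_normal_trans (pcore_char _ _) nsKG.
Qed.

(** [r] is only an upper bound for the primes dividing [#|G|], so that the hypothesis passes to
    quotients whose order [r] may no longer divide. *)
Lemma sylow_submodular_max_normal r (gT : finGroupType) (G R : {group gT}) :
    sylow_submodular G -> {in \pi(G), forall q, q <= r} -> r.-Sylow(G) R ->
  R <| G.
Proof.
have [n] := ubnP #|G|; elim: n gT G R => // n IHn gT G R /ltnSE leGn subG maxr sylR.
apply: contraT => not_nsRG; have [sRG rR _] := and3P sylR.
have [g Gg not_nRg] : exists2 g, g \in G & g \notin 'N(R).
  by apply/subsetPn; apply: contra not_nsRG; rewrite /normal sRG.
have ltRG : R \proper G.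
  rewrite properE sRG; apply: contra not_nsRG => sGR.
  by rewrite (_ : R = G) ?normal_refl //; apply/val_inj/eqP; rewrite eqEsubset sRG.
have [M ltMG [modM sRM]] : exists2 M : {group gT}, M \proper G & modular M G /\ R \subset M.
  apply: submodular_proper ltRG; apply: subG; exact: p_Sylow sylR.
have [sMG _ modY] := modularP _ _ modM.
have nsR (L : {group gT}) : L \proper G -> R \subset L -> R <| L.
  move=> ltLG sRL; have sLG := proper_sub ltLG; apply: IHn.
  - exact: leq_trans (proper_card ltLG) leGn.
  - exact: sylow_submodularS subG.
  - by move=> q /(pi_of_dvd (cardSg sLG) (cardG_gt0 G)); apply: maxr.
  - exact: pHall_subl sylR.
have sLN (L : {group gT}) : L \proper G -> R \subset L -> L \subset 'N_G(R).
  by move=> ltLG sRL; rewrite subsetI proper_sub // normal_norm ?nsR.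
have sylQ : r.-Sylow(G) (R :^ g) by rewrite pHallJ.
(* In a proper subgroup containing [M] and [R :^ g], [R] would be normal and conjugate to [R :^ g],
   against the choice of [g]. *)
have genMQ : M <*> (R :^ g) = G.
  have sLG : M <*> (R :^ g) \subset G by rewrite join_subG sMG (pHall_sub sylQ).
  apply/eqP; rewrite eqEproper sLG; apply: contra not_nRg => ltLG.
  have sRL : R \subset M <*> (R :^ g) by rewrite (subset_trans sRM) ?joing_subl.
  have [x Lx defQ] := Sylow_trans (pHall_subl sRL sLG sylR)
    (pHall_subl (joing_subr _ _) sLG sylQ).
  rewrite inE defQ (normP _) //; apply: subsetP Lx.
  by apply: normal_norm; apply: (nsR (M <*> (R :^ g))%G).
have ltNG : 'N_G(R) \proper G.
  rewrite properE subsetIl; apply: contra not_nRg => /subsetP/(_ g Gg).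
  by case/setIP.
have nsRN : R <| 'N_G(R) by rewrite normalSG.
have defM : M :=: 'N_G(R).
  have sylRN := pHall_subl (normal_sub nsRN) (subsetIl _ _) sylR.
  have sMN := sLN M ltMG sRM.
  (* In the second law with [Z = 'N_G(R)] the join is [G], and [R :^ g :&: 'N_G(R)] is an
     [r]-subgroup of ['N_G(R)], hence inside [R], so that ['N_G(R)] collapses to [M]. *)
  have := modY (R :^ g)%G 'N_G(R)%G (pHall_sub sylQ) sMN (subsetIl _ _).
  rewrite genMQ /= (setIidPr (subsetIl _ _)) => <-; apply/esym/joing_idPl.
  apply: subset_trans sRM; rewrite (sub_normal_Hall sylRN) ?subsetIr //.
  by rewrite (pgroupS (subsetIl _ _)) // (pHall_pgroup sylQ).
have maxM : maximal M G.
  apply/maxgroupP; split=> // L ltLG sML; apply/eqP.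
  by rewrite eqEsubset sML defM sLN // (subset_trans sRM).
(* A nontrivial core [E] is factored out: induction makes [E <*> R] normal in [G], and [R] is normal
   in [E <*> R], which lies in [M]. *)
have [coreM | ntE] := eqVneq (gcore M G) 1; last first.
  pose E := gcore_group M G.
  have nsEG : E <| G := gcore_normal sMG; have [sEG nEG] := andP nsEG.
  have nER := subset_trans sRG nEG.
  have : (R / E)%G <| (G / E)%G.
    apply: IHn; first by apply: leq_trans leGn; rewrite ltn_quotient.
    - exact: sylow_submodular_quotient.
    - move=> q /(pi_of_dvd (dvdn_quotient _ _) (cardG_gt0 G)); exact: maxr.
    - exact: quotient_pHall.
  rewrite -cosetpre_normal (quotientGK nsEG) quotientK // -norm_joinEr // => nsERG.
  have sRER : R \subset E <*> R := joing_subr _ _.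
  rewrite -(negPf not_nsRG); apply: (normal_pHall_sub_trans sylR sRER _ nsERG).
  apply: (nsR (E <*> R)%G) => //; apply: sub_proper_trans ltMG.
  by rewrite join_subG sRM gcore_sub.
have G_gt1 : 1 < #|G|.
  rewrite cardG_gt1; apply: contra not_nsRG => /eqP G1.
  by rewrite (_ : R :=: 1) ?normal1 //; apply/trivgP; rewrite -G1.
pose p := pdiv #|G|; have p_pr : prime p by rewrite pdiv_prime.
have minp : {in \pi(G), forall q, p <= q}.
  by move=> q; rewrite mem_primes => /and3P[/prime_gt1 q_gt1 _ qG]; apply: pdiv_min_dvd.
have [K nsKG hallK] := maximal_modular_nilpotent maxM modM coreM p_pr minp.
have piG : p \in \pi(G) by rewrite pi_pdiv.
have ltKG : K \proper G.
  rewrite properE normal_sub //; apply/negP => sGK.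
  have := pi_of_dvd (cardSg sGK) (cardG_gt0 K) piG.
  by move/(pnatPpi (pHall_pgroup hallK)); rewrite inE /= inE eqxx.
(* If [r] were also the smallest prime, [G] would be an [r]-group, equal to [R]. *)
have ltpr : r != p.
  apply: contra not_nsRG => /eqP def_r; rewrite (pHall_id sylR) ?normal_refl //.
  apply/pgroupP=> q q_pr qG; have Gq : q \in \pi(G) by rewrite mem_primes q_pr cardG_gt0.
  by rewrite inE eqn_leq maxr // def_r minp.
have sRK : R \subset K.
  rewrite (sub_normal_Hall hallK) //; apply: sub_pgroup rR => q; rewrite !inE.
  by move/eqP->.
rewrite -(negPf not_nsRG).
exact: normal_pHall_sub_trans sylR sRK (nsR K ltKG sRK) nsKG.
Qed.

(** * Ore dispersive groups *)

Section OreDispersive.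

Lemma part_prod_primes (n : nat) (pi : nat_pred) :
  (\prod_(p <- [seq p <- rev (primes n) | p \in pi]) n`_p = n`_pi)%N.
Proof.
have [-> | n_gt0] := posnP n; first by rewrite partn0 big_nil.
rewrite filter_rev (perm_big [seq p <- primes n | p \in pi]) ?perm_rev //=.
rewrite (@eq_in_partn pi [predI pi & \pi(n)]) => [|p pn]; last first.
  by rewrite [RHS]inE /= pn andbT.
rewrite [RHS]/partn -[RHS]big_filter filter_predI filter_pi_of //.
by apply: eq_bigr => p _; rewrite p_part.
Qed.

Lemma gtn_sorted_filter (s : seq nat) k :
  sorted gtn s -> [seq p <- s | k <= p] = take (count (leq k) s) s.
Proof.
elim: s => //= x s IHs; rewrite path_sortedE; last exact: (rev_trans ltn_trans).
case/andP=> /allP ltx /IHs IH; case: ifP => [_ | /negbT]; first by rewrite IH.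
rewrite -ltnNge => ltxk.
have noS y : y \in s -> ~~ (k <= y).
  by move=> /ltx /= ltyx; rewrite -ltnNge (ltn_trans ltyx).
have -> : count (leq k) s = 0.
  by apply/eqP; rewrite -leqn0 leqNgt -has_count; apply/hasPn.
by rewrite take0; apply/eqP; rewrite -size_eq0 size_filter -leqn0 leqNgt -has_count; apply/hasPn.
Qed.

Lemma gtn_sorted_take (s : seq nat) i :
  sorted gtn s -> i < size s -> take i.+1 s = [seq p <- s | nth 0 s i <= p].
Proof.
elim: s i => //= x s IHs i; rewrite path_sortedE; last exact: (rev_trans ltn_trans).
case/andP=> /allP ltx s_sorted; case: i => [_ | i lti] /=.
  rewrite leqnn take0; congr (_ :: _); apply/esym/eqP.
  rewrite -size_eq0 size_filter -leqn0 leqNgt -has_count; apply/hasPn=> y /ltx /=.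
  by rewrite -ltnNge.
have /= lt_x := ltx _ (mem_nth 0 lti).
by rewrite (ltnW lt_x) -IHs.
Qed.

(** Prefixes of the decreasing list of primes are cut out by the conditions [k <= q]; Hall subgroups
    for these are easier to carry through inductions. *)
Lemma ore_dispersiveP (gT : finGroupType) (G : {group gT}) :
  ore_dispersive G <->
  (forall k, exists2 N : {group gT}, N <| G & [pred q | k <= q].-Hall(G) N).
Proof.
have sorted_ps : sorted gtn (rev (primes #|G|)) by rewrite rev_sorted sorted_primes.
have HallE (N : {group gT}) k : N \subset G ->
    [pred q | k <= q].-Hall(G) N =
      (#|N| == \prod_(p <- [seq p <- rev (primes #|G|) | k <= p]) #|G|`_p)%N.
  move=> sNG; rewrite (part_prod_primes _ [pred q | k <= q]); apply/idP/eqP.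
    exact: card_Hall.
  by move=> oN; rewrite pHallE sNG oN eqxx.
split=> [ore k | tower ps i lti]; last first.
  (* The prefix of length [i.+1] is determined by its last entry, the prime of index [i]. *)
  move: lti; case: i => // i lti; have [N nsNG] := tower (nth 0 (rev (primes #|G|)) i).
  rewrite HallE ?normal_sub // => /eqP oN; exists N => //.
  by rewrite /ps gtn_sorted_take.
(* [ore_dispersive] starts at [i = 1], so when no prime reaches [k] the trivial subgroup is supplied
   by hand. *)
have [i0 | i_gt0] := posnP (count (leq k) (rev (primes #|G|))).
  exists 1%G; rewrite ?normal1 // HallE ?sub1G //.
  by rewrite gtn_sorted_filter // i0 take0 big_nil cards1.
have [|N nsNG oN] := ore (count (leq k) (rev (primes #|G|))).
  by rewrite i_gt0 count_size.
by exists N => //; rewrite HallE ?normal_sub // gtn_sorted_filter // oN.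
Qed.

(** The normal Sylow [r]-subgroup [R] is factored out; if [k <= r], a Hall subgroup of [G / R] pulls
    back to the required one. *)
Lemma sylow_submodular_ore_dispersive (gT : finGroupType) (G : {group gT}) :
  sylow_submodular G -> ore_dispersive G.
Proof.
move=> subG; apply/ore_dispersiveP=> k; have [n] := ubnP #|G|.
elim: n gT G subG => // n IHn gT G subG /ltnSE leGn.
pose r := max_pdiv #|G|; have maxr : {in \pi(G), forall q, q <= r}.
  by move=> q; apply: max_pdiv_max.
have [lekr | ltrk] := leqP k r; last first.
  exists 1%G; rewrite ?normal1 // pHallE sub1G cards1 eq_sym.
  rewrite partn_eq1 ?cardG_gt0 //; apply/pnatP=> // q q_pr qG.
  by rewrite !inE -ltnNge (leq_ltn_trans _ ltrk) // maxr // mem_primes q_pr cardG_gt0.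
have [G1 | ntG] := eqVneq G 1%G.
  by exists G; rewrite ?normal_refl // G1 pHallE subxx cards1 partn1.
have [R sylR] := Sylow_exists r G.
have nsRG := sylow_submodular_max_normal subG maxr sylR.
have ntR : R :!=: 1.
  by rewrite trivg_card1 (card_Hall sylR) p_part_eq1 negbK pi_max_pdiv cardG_gt1.
have [|N] := IHn _ (G / R)%G (sylow_submodular_quotient nsRG subG).
  by apply: leq_trans leGn; rewrite ltn_quotient ?normal_sub.
case/(inv_quotientN nsRG) => N1 defN sRN1 nsN1G; rewrite defN => hallN1.
exists N1 => //; rewrite -(pquotient_pHall _ nsRG) //.
  by apply: sub_pgroup (pHall_pgroup sylR) => q; rewrite !inE => /eqP->.
by rewrite /normal sRN1 (subset_trans (normal_sub nsN1G)) ?normal_norm.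
Qed.

End OreDispersive.

(** * Supersolubility with at most two prime divisors *)

(** A series of [G / N] pulls back to one from [N] to [G] with isomorphic factors; the step from [1]
    to [N] is put in front. *)
Lemma supersoluble_lift (gT : finGroupType) (G N : {group gT}) :
  N <| G -> cyclic N -> supersoluble (G / N)%G -> supersoluble G.
Proof.
move=> nsNG cycN [s s_path s_last]; have [sNG nNG] := andP nsNG.
pose f (K : {group coset_of N}) := (coset N @*^-1 K)%G.
have f1 : f 1%G = N by apply: val_inj; rewrite /= -kerE ker_coset.
have fG : f (G / N)%G = G by apply: val_inj; rewrite /= quotientGK.
have fcyc U V :
    cyclic_normal_factor (G / N)%G U V -> cyclic_normal_factor G (f U) (f V).
  case/and4P=> nsU nsV sUV cycUV.
  have nsfG (W : {group coset_of N}) : W <| G / N -> f W <| G.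
    by rewrite -[in X in _ -> X]fG cosetpre_normal.
  have sNf (W : {group coset_of N}) : N \subset f W.
    by rewrite -{1}(ker_coset N) ker_sub_pre.
  rewrite /cyclic_normal_factor !nsfG //= morphpreS //=.
  have nsN : N <| f V by rewrite /normal sNf (subset_trans (normal_sub (nsfG _ nsV))).
  have nsUV : f U <| f V.
    by rewrite cosetpre_normal /normal sUV (subset_trans (normal_sub nsV)) ?normal_norm.
  rewrite -(isog_cyclic (third_isog (sNf U) nsN nsUV)) /=.
  by rewrite !cosetpreK.
exists (N :: map f s) => /=; last by rewrite -[X in last X _]f1 last_map s_last.
apply/andP; split.
  by rewrite /cyclic_normal_factor normal1 nsNG sub1G -(isog_cyclic (quotient1_isog N)).
by rewrite -[X in path _ X _]f1 path_map; apply: sub_path s_path => U V; apply: fcyc.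
Qed.

(** [Q] is a Sylow subgroup for the smallest prime, or trivial when [G] is an [r]-group. The bound
    [<= 2], unlike [biprimary], passes to quotients. *)
Lemma biprimary_complement (gT : finGroupType) (G : {group gT}) :
    let r := max_pdiv #|G| in
    size (primes #|G|) <= 2 -> sylow_submodular G ->
  forall R : {group gT}, r.-Sylow(G) R ->
  exists Q : {group gT}, [/\ submodular Q G, R * Q = G & R :&: Q = 1].
Proof.
move=> r size2 subG R sylR; have [sRG rR _] := and3P sylR.
have [G1 | ntG] := eqVneq G 1%G.
  exists G; split; first exact: submodular_refl.
    by apply/mulSGid.
  by apply/trivgP; apply: subset_trans (subsetIr R G) _; rewrite G1.
have G_gt1 : 1 < #|G| by rewrite cardG_gt1.
pose q := pdiv #|G|; have Gq : q \in \pi(G) by rewrite pi_pdiv.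
have Gr : r \in \pi(G) by rewrite pi_max_pdiv.
have [eq_qr | neq_qr] := eqVneq q r.
  exists 1%G; split; [|rewrite mulg1|by rewrite (setIidPr (sub1G R))].
    exact: submodular_step (normal_modular (normal1 G)) (submodular_refl G).
  rewrite -(pHall_id sylR) //; apply/pgroupP=> p p_pr pG.
  have Gp : p \in \pi(G) by rewrite mem_primes p_pr cardG_gt0.
  rewrite inE eqn_leq max_pdiv_max //= -/r -eq_qr.
  by rewrite pdiv_min_dvd // prime_gt1.
have [Q sylQ] := Sylow_exists q G; have [sQG qQ _] := and3P sylQ.
exists Q; split; first by apply: subG; apply: p_Sylow sylQ.
  have defpi : \pi(G) =i [:: q; r].
    have uqr : uniq [:: q; r] by rewrite /= inE neq_qr.
    have sqr : {subset [:: q; r] <= primes #|G|}.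
      by move=> x; rewrite !inE => /orP[] /eqP->.
    by have [_ eqi] := uniq_min_size uqr sqr size2; move=> p; rewrite eqi.
  apply/eqP; rewrite eqEcard mul_subG //=.
  rewrite coprime_cardMg; last first.
    rewrite (pnat_coprime rR) // (pi_pnat qQ) // inE /= inE //.
  rewrite (card_Hall sylR) (card_Hall sylQ).
  rewrite -[leqLHS](partnC r) ?cardG_gt0 // leq_mul2l; apply/orP; right.
  rewrite (@eq_in_partn r^' q) // => p; rewrite defpi !inE.
  by case/orP=> /eqP->; rewrite ?eqxx ?neq_qr // eq_sym (negPf neq_qr).
apply: coprime_TIg; rewrite (pnat_coprime rR) // (pi_pnat qQ) // inE /= inE //.
Qed.

Lemma sylow_submodular_minnormal (gT : finGroupType) (G : {group gT}) :
    G :!=: 1 -> size (primes #|G|) <= 2 -> sylow_submodular G ->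
  exists2 N : {group gT}, N <| G & prime #|N|.
Proof.
move=> ntG size2 subG; pose r := max_pdiv #|G|.
have [R sylR] := Sylow_exists r G; have [sRG rR _] := and3P sylR.
have nsRG : R <| G.
  by apply: (sylow_submodular_max_normal subG _ sylR) => q; apply: max_pdiv_max.
have [Q [subQ defG tiRQ]] := biprimary_complement size2 subG sylR.
have ntR : R :!=: 1.
  by rewrite trivg_card1 (card_Hall sylR) p_part_eq1 negbK pi_max_pdiv cardG_gt1.
have [N minN sNR] := minnormal_exists ntR (normal_norm nsRG).
have [/andP[ntN nNG] minN'] := mingroupP minN.
have sNG := subset_trans sNR sRG.
have sQG := submodular_sub subQ.
have nsNR : N <| R by rewrite /normal sNR (subset_trans sRG).
(* [N] meets the centre of the [r]-group [R] nontrivially, and minimality puts [N] inside that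
   centre. *)
have cRN : R \subset 'C(N).
  have ntZ := meet_center_nil (pgroup_nil rR) nsNR ntN.
  have nsZG : 'Z(R) <| G := char_normal_trans (center_char R) nsRG.
  have defZ : N :&: 'Z(R) = N.
    apply: (minN' (N :&: 'Z(R))%G); rewrite ?subsetIl //= ntZ normsI //.
    exact: normal_norm.
  rewrite centsC -defZ.
  by rewrite (subset_trans (subsetIr _ _)) ?subsetIr.
have nNQ := subset_trans sQG nNG.
pose L := (N <*> Q)%G.
have sLG : L \subset G by rewrite join_subG sNG.
have tiNQ : N :&: Q = 1 by apply/trivgP; rewrite -tiRQ setSI.
have maxQ : maximal Q L.
  apply/maxgroupP; split=> [|H ltHL sQH].
    rewrite properE joing_subr join_subG subxx andbT.
    by apply: contra ntN => /setIidPl sNQ; rewrite -sNQ tiNQ.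
  have sHL := proper_sub ltHL.
  (* [R] centralises [N] and [Q] lies in [H], so [R * Q = G] normalises [N :&: H], which is
     therefore [1] or [N]. *)
  have nI : G \subset 'N(N :&: H).
    rewrite -defG mul_subG //.
      by apply: cents_norm; rewrite (subset_trans cRN) // centS // subsetIl.
    by rewrite normsI // (subset_trans sQH) ?normG.
  have [tiNH | ntI] := eqVneq (N :&: H) 1.
    rewrite -(setIidPr sHL) /= norm_joinEr //.
    by rewrite setIC -group_modr // setIC tiNH mul1g.
  have defI : N :&: H = N by apply: (minN' (N :&: H)%G); rewrite ?subsetIl //= ntI.
  have sNH : N \subset H by rewrite -defI subsetIr.
  by case/negP: (proper_subn ltHL); rewrite join_subG sNH.
have subQL : submodular Q L.
  have := submodularI sLG subQ; congr (submodular _ _); apply: val_inj => /=.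
  exact/setIidPl/joing_subr.
(* As [Q] is maximal in [L], the proper modular subgroup [K] above it is [Q] itself. *)
have [K ltKL [modK sQK]] := submodular_proper subQL (maxgroupp maxQ).
have defK : K = Q by apply: val_inj; have [_] := maxgroupP maxQ; apply.
rewrite defK in modK.
have := maximal_modular_setI maxQ modK (joing_subl N Q).
rewrite tiNQ => /predU1P[N1 | max1]; first by rewrite N1 eqxx in ntN.
exists N; first by rewrite /normal sNG.
rewrite -indexg1 (p_maximal_index (pgroupS sNR rR) max1).
by rewrite max_pdiv_prime // cardG_gt1.
Qed.

Lemma sylow_submodular_supersoluble (gT : finGroupType) (G : {group gT}) :
  size (primes #|G|) <= 2 -> sylow_submodular G -> supersoluble G.
Proof.
have [n] := ubnP #|G|; elim: n gT G => // n IHn gT G /ltnSE leGn size2 subG.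
have [-> | ntG] := eqVneq G 1%G; first by exists [::].
have [N nsNG N_pr] := sylow_submodular_minnormal ntG size2 subG.
apply: (supersoluble_lift nsNG (prime_cyclic N_pr)); apply: IHn.
- apply: leq_trans leGn; rewrite ltn_quotient ?normal_sub //.
  by rewrite -cardG_gt1 prime_gt1.
- apply: leq_trans size2; apply: uniq_leq_size (primes_uniq _) _ => p.
  exact: (pi_of_dvd (dvdn_quotient G N) (cardG_gt0 G)).
exact: sylow_submodular_quotient.
Qed.

(** * The converse: from biprimary subgroups to the whole group *)

Lemma biprimary_joing p r (gT : finGroupType) (P R : {group gT}) :
    prime p -> prime r -> p != r -> p.-group P -> r.-group R ->
    P :!=: 1 -> R :!=: 1 -> P \subset 'N(R) ->
  biprimary (R <*> P)%G.
Proof.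
move=> p_pr r_pr neq_pr pP rR ntP ntR nRP.
have coRP : coprime #|R| #|P|.
  by rewrite (pnat_coprime rR) // (pi_pnat pP) // inE /= inE.
have primesE q (A : {group gT}) : prime q -> q.-group A -> A :!=: 1 ->
    primes #|A| = [:: q].
  move=> q_pr qA ntA; have [_ _ [m ->]] := pgroup_pdiv qA ntA.
  by rewrite primesX // primes_prime.
rewrite /biprimary /= norm_joinEr // coprime_cardMg //.
rewrite (perm_size (_ : perm_eq _ [:: p; r])) //.
apply: uniq_perm; rewrite ?primes_uniq //= ?inE ?neq_pr // => q.
by rewrite primesM // (primesE r R) // (primesE p P) // !inE orbC.
Qed.

Lemma ore_dispersive_submodular (gT : finGroupType) (G : {group gT}) :
    (forall k, exists2 N : {group gT}, N <| G & [pred q | k <= q].-Hall(G) N) ->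
    (forall H : {group gT}, H \subset G -> biprimary H -> sylow_submodular H) ->
  sylow_submodular G.
Proof.
have [n] := ubnP #|G|; elim: n G => // n IHn G /ltnSE leGn tower subH.
move=> P /SylowP[p p_pr sylP]; have [sPG pP _] := and3P sylP.
have [P1 | ntP] := eqVneq P 1%G.
  rewrite P1; exact: submodular_step (normal_modular (normal1 G)) (submodular_refl G).
have ntG : G :!=: 1 by apply: contra ntP => /eqP G1; rewrite -val_eqE /= -subG1 -G1.
pose r := max_pdiv #|G|; have r_pr : prime r by rewrite max_pdiv_prime // cardG_gt1.
(* No prime divisor exceeds [r], so the Hall subgroup for [k = r] is a normal Sylow [r]-subgroup. *)
have [R nsRG] := tower r.
have {1}-> : [pred q | r <= q].-Hall(G) R = r.-Sylow(G) R.
  apply: eq_in_pHall => q Gq; rewrite !inE eqn_leq.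
  by rewrite (max_pdiv_max Gq).
move=> sylR; have [sRG rR _] := and3P sylR.
have [eq_pr | neq_pr] := eqVneq p r.
  have nsPG : P <| G.
    rewrite eq_pr in sylP; have [x Gx ->] := Sylow_trans sylR sylP.
    by rewrite (normP _) // (subsetP (normal_norm nsRG)).
  exact: submodular_step (normal_modular nsPG) (submodular_refl G).
have ntR : R :!=: 1.
  by rewrite trivg_card1 (card_Hall sylR) p_part_eq1 negbK pi_max_pdiv cardG_gt1.
have nRP := subset_trans sPG (normal_norm nsRG).
(* A Schur-Zassenhaus complement contains some Sylow [p]-subgroup of [G], so a conjugate of it
   contains [P]. *)
have [H0 /complP[tiRH0 defG0]] := splitsP (SchurZassenhaus_split (pHall_Hall sylR) nsRG).
have sH0G : H0 \subset G by rewrite -defG0 mulG_subr.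
have [P0 sylP0] := Sylow_exists p H0.
have sylP0G : p.-Sylow(G) P0.
  have [sP0H0 pP0 p'H0P0] := and3P sylP0.
  have oGH0 : #|G : H0| = #|R| by rewrite -divgS // -{1}defG0 TI_cardMg ?mulnK.
  rewrite /pHall (subset_trans sP0H0) // pP0 -(Lagrange_index sH0G sP0H0) oGH0.
  by rewrite pnatM p'H0P0 andbT (pi_pnat rR) // inE /= inE eq_sym.
have [x Gx defP] := Sylow_trans sylP0G sylP.
pose H := (H0 :^ x)%G.
have nRx : R :^ x = R by rewrite (normP _) // (subsetP (normal_norm nsRG)).
have defG : R * H = G by rewrite /= -{1}nRx -conjsMg defG0 conjGid.
have sHG : H \subset G by rewrite -defG mulG_subr.
have sPH : P \subset H by rewrite defP conjSg (pHall_sub sylP0).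
have subPH : submodular P H.
  have subH' : sylow_submodular H.
    apply: IHn => [|k|K sKH biK].
    - apply: leq_trans leGn; rewrite cardJg -defG0 TI_cardMg //.
      by rewrite ltn_Pmull ?cardG_gt0 // cardG_gt1.
    - have [N nsNG hallN] := tower k.
      exists (N :&: H)%G; last exact: setI_normal_Hall hallN sHG.
      by rewrite /= setIC (normalGI sHG).
    by apply: subH; rewrite // (subset_trans sKH).
  apply: subH'; apply: p_Sylow (pHall_subl sPH sHG sylP).
have sRPG : R <*> P \subset G by rewrite join_subG sRG.
apply: (submodular_trans (L := (R <*> P)%G)).
  apply: subH => //; first exact: (biprimary_joing p_pr r_pr).
  exact: p_Sylow (pHall_subl (joing_subr _ _) sRPG sylP).
(* Modulo [R], the groups [R <*> P] and [G] have the same images as [P] and [H], so [subPH]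
   transfers. *)
apply: (submodular_normal_sup nsRG (joing_subl _ _) sRPG).
have nRH := subset_trans sHG (normal_norm nsRG).
have := submodular_quotient nRH subPH.
congr (submodular _ _); apply: val_inj => /=; first by rewrite quotientYidl.
by rewrite -defG quotientMidl.
Qed.

Theorem theorem3p8 (gT : finGroupType) (G : {group gT}) :
  (forall P : {group gT}, Sylow G P -> submodular P G) <->
  (ore_dispersive G /\
   forall H : {group gT}, H \subset G -> biprimary H -> strongly_supersoluble H).
Proof.
split=> [subG | [/ore_dispersiveP tower supH]].
  split=> [|H sHG /eqP biH]; first exact: sylow_submodular_ore_dispersive.
  have subH := sylow_submodularS sHG subG.
  by split=> //; apply: sylow_submodular_supersoluble; rewrite ?biH.
apply: ore_dispersive_submodular tower _ => H sHG biH.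
by have [] := supH H sHG biH.
Qed.
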